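(* For every non-discrete metrizable space $X$, the following two sets are dense $G_\delta$ subsets of $\mathrm{Met}(X)$: (1) the set of all metrics $d\in\mathrm{Met}(X)$ for which $(X,d)$ is not doubling; (2) the set of all metrics $d\in\mathrm{Met}(X)$ for which $(X,d)$ is not uniformly disconnected.
   Context: For a metrizable space $X$, $\mathrm{Met}(X)$ denotes the set of all metrics on $X$ generating the topology of $X$, equipped with the topology generated by the $[0,\infty]$-valued metric $\mathcal{D}_X(d,e)=\sup_{(x,y)\in X^2}|d(x,y)-e(x,y)|$. For a metric space $(X,d)$ and $A\subset X$, $\delta_d(A)$ is the diameter of $A$ and $\alpha_d(A)=\inf\{d(x,y)\mid x,y\in A,\ x\neq y\}$. $(X,d)$ is doubling if there exist $C\in(0,\infty)$ and $\lambda\in(0,\infty)$ such that for every finite subset $A$ of $X$ with at least two points, $\mathrm{card}(A)\le C\left(\delta_d(A)/\alpha_d(A)\right)^{\lambda}$. $(X,d)$ is uniformly disconnected if there exists $\delta\in(0,1)$ such that every finite sequence $\{z_i\}_{i=1}^N$ in $X$ with $N>1$ satisfies $\max_{1\le i\le N-1}d(z_i,z_{i+1})\ge\delta\, d(z_1,z_N)$. *)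

(* Defs.v *)
From HB Require Import structures.
From mathcomp Require Import all_boot all_order all_algebra finmap.
From mathcomp Require Import all_classical all_reals all_analysis borel_hierarchy.

Set Implicit Arguments.
Unset Strict Implicit.
Unset Printing Implicit Defensive.

Import Order.TTheory GRing.Theory Num.Theory.

Local Open Scope classical_set_scope.
Local Open Scope ring_scope.

Record is_metric (R : realType) (X : Type) (d : X -> X -> R) : Prop := {
  dist_ge0 : forall x y, 0 <= d x y ;
  dist_eq0 : forall x y, d x y = 0 <-> x = y ;
  dist_sym : forall x y, d x y = d y x ;
  dist_triangle : forall y x z, d x z <= d x y + d y z
}.

Definition generates_topology (R : realType) (X : topologicalType)
    (d : X -> X -> R) : Prop :=
  forall U : set X, open U <->
    forall x, U x -> exists2 r : R, 0 < r & [set y | d x y < r] `<=` U.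

Record Met (R : realType) (X : topologicalType) : Type := MkMet {
  met_fun :> X -> X -> R ;
  met_is_metric : is_metric met_fun ;
  met_generates : generates_topology met_fun
}.

Definition metrizable (R : realType) (X : topologicalType) : Prop :=
  exists d : X -> X -> R, is_metric d /\ generates_topology d.

Definition discrete_space (X : topologicalType) : Prop :=
  forall A : set X, open A.

Section MetTopology.
Context (R : realType) (X : topologicalType).
Local Open Scope ereal_scope.
Implicit Types d e f : Met R X.

(* For empty X this is the supremum of the empty set, -oo instead of 0; the
   balls of positive radius are the same. *)
Definition met_dist d e : \bar R :=
  ereal_sup [set `|d xy.1 xy.2 - e xy.1 xy.2|%:E | xy in [set: X * X]].

Definition met_ball d (r : R) : set (Met R X) := [set e | met_dist d e < r%:E].

Lemma met_ball_center d (r : R) : (0 < r)%R -> met_ball d r d.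
Proof.
move=> r0; rewrite /met_ball /=; apply: (@le_lt_trans _ _ 0); last first.
  by rewrite lte_fin.
by apply: ge_ereal_sup => _ [xy _ <-]; rewrite subrr normr0.
Qed.

Lemma met_ball_sym d e (r : R) : met_ball d r e -> met_ball e r d.
Proof.
rewrite /met_ball /=; congr (_ < _); congr ereal_sup.
by apply: eq_imagel => xy _; rewrite distrC.
Qed.

Lemma met_ball_triangle d e f (r s : R) :
  met_ball d r e -> met_ball e s f -> met_ball d (r + s) f.
Proof.
rewrite /met_ball /= => de ef; rewrite EFinD.
apply: le_lt_trans (lteD de ef).
apply: ge_ereal_sup => _ [xy _ <-].
apply: (@le_trans _ _ (`|d xy.1 xy.2 - e xy.1 xy.2|%:E +
                       `|e xy.1 xy.2 - f xy.1 xy.2|%:E)).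
  by rewrite -EFinD lee_fin; apply: ler_distD.
by apply: leeD; apply: ereal_sup_ubound; exists xy.
Qed.

HB.instance Definition _ := gen_eqMixin (Met R X).
HB.instance Definition _ := gen_choiceMixin (Met R X).
HB.instance Definition _ :=
  hasNbhs.Build (Met R X) (nbhs_ (entourage_ met_ball)).
HB.instance Definition _ := @Nbhs_isPseudoMetric.Build R (Met R X)
  (entourage_ met_ball) erefl met_ball met_ball_center met_ball_sym
  met_ball_triangle erefl.

Lemma open_MetE (U : set (Met R X)) : open U <->
  forall d, U d -> exists2 r : R, (0 < r)%R & [set e | met_dist d e < r%:E] `<=` U.
Proof.
rewrite openE; split=> UO d /UO; first by move=> /nbhs_ballP.
by move=> h; apply/nbhs_ballP.
Qed.

End MetTopology.

Section MetricProperties.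
Context (R : realType) (X : choiceType) (d : X -> X -> R).

Definition diameter (A : set X) : \bar R :=
  ereal_sup [set t | exists x y, [/\ A x, A y & t = (d x y)%:E]].

Definition separation (A : set X) : \bar R :=
  ereal_inf [set t | exists x y, [/\ A x, A y, x <> y & t = (d x y)%:E]].

(* Both extended reals are finite, and the second is positive, when d is a
   metric and A is finite with at least two points. *)
Definition doubling : Prop :=
  exists C lambda : R, [/\ 0 < C, 0 < lambda &
    forall A : {fset X}, (2 <= #|` A|)%N ->
      #|` A|%:R <=
        C * (fine (diameter [set` A]) / fine (separation [set` A])) `^ lambda].

(* Only the values z 1, ..., z N are used. *)
Definition uniformly_disconnected : Prop :=
  exists2 delta : R, 0 < delta < 1 &
    forall (N : nat) (z : nat -> X), (1 < N)%N ->
      delta * d (z 1%N) (z N) <=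
        \big[Num.max/0]_(1 <= i < N) d (z i) (z i.+1).

End MetricProperties.

(* Main.v *)
Require Import Defs.
From mathcomp Require Import all_boot all_order all_algebra finmap.
From mathcomp Require Import all_classical all_reals all_analysis borel_hierarchy.
From mathcomp Require Import ring lra.

Set Implicit Arguments.
Unset Strict Implicit.
Unset Printing Implicit Defensive.

Import Order.TTheory GRing.Theory Num.Theory.

Local Open Scope classical_set_scope.
Local Open Scope ring_scope.

(** Both sets are G_delta because each of the two properties fails exactly when,
    for every [n], some finite configuration of points satisfies finitely many
    strict inequalities between its distances ([not_doublingP],
    [not_uniformly_disconnectedP]). The distance of two fixed points depends
    continuously on the metric, uniformly in the points, so for fixed [n] this
    is an open condition.

    For density, let [d] generate the topology and let [rho] be a
    pseudometric that is continuous for [d] and bounded by [r]. Then [d + rho]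
    is a metric generating the same topology, at distance at most [r] from
    [d], so it suffices to choose [rho] such that [d + rho] has the required
    defect near a non-isolated point [p]. Both choices come from one
    subadditive modulus [eta], tending to [0] at [0], and one sequence of
    finite sets [A_k] containing [p], with [k + 2] points, such that [eta] is
    constant, equal to [h_k = b / (k + 1)] for [b = min (r, 1)], on the
    positive distances realized in [A_k], while these distances are at most [h_k ^ 2]
    ([plateau_clusters]). Such an [eta] is a supremum of ramps
    [t |-> min (h_k, c_k t)] whose slopes increase fast enough.

    - With [rho x y = eta (d x y)] the sets [A_k] become equilateral up to a
      factor 2: all their distances lie between [h_k] and [2 h_k], although their
      cardinalities are unbounded. So [d + rho] is not doubling.
    - With [rho x y = |eta (d p x) - eta (d p y)|], pick [x_k] in [A_k]
      other than [p]. Up to errors of order [1 / M ^ 2], the chain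
      [x_M, ..., x_(2M+1)] is placed like the numbers [h_M, ..., h_(2M+1)]:
      its steps are of order [1 / M ^ 2] and its ends are at a distance of
      order [1 / M]. So [d + rho] is not uniformly disconnected. *)

(** * Moduli with prescribed plateaus *)

Record modulus (R : realType) (eta : R -> R) : Prop := {
  modulus0 : eta 0 = 0 ;
  modulus_le : forall s t, 0 <= s -> s <= t -> eta s <= eta t ;
  modulusD : forall s t, 0 <= s -> 0 <= t -> eta (s + t) <= eta s + eta t ;
  modulus_lt : forall r, 0 < r ->
    exists2 s, 0 < s & forall t, 0 <= t -> t < s -> eta t < r
}.

(** A bounded supremum of concave ramps is subadditive and nondecreasing for all
    positive heights and slopes, which are left free in order to prescribe the
    values of the supremum at given points. *)
Definition sup_ramps (R : realType) (h c : nat -> R) (t : R) : R :=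
  sup (range (fun k => Num.min (h k) (c k * t))).

Section SupRamps.
Context (R : realType) (h c : nat -> R).
Hypothesis h_gt0 : forall k, 0 < h k.
Hypothesis h_noninc : forall j k, (j <= k)%N -> h k <= h j.
Hypothesis h_cvg0 : forall r, 0 < r -> exists K, h K < r.
Hypothesis c_gt0 : forall k, 0 < c k.

Lemma sup_ramps_ge t k : Num.min (h k) (c k * t) <= sup_ramps h c t.
Proof.
apply: ub_le_sup; last by exists k.
exists (h 0%N) => _ [j _ <-]; rewrite ge_min; apply/orP; left.
exact: h_noninc.
Qed.

Lemma sup_ramps_le t u :
  (forall k, Num.min (h k) (c k * t) <= u) -> sup_ramps h c t <= u.
Proof.
move=> tu; apply: ge_sup; first by exists (Num.min (h 0%N) (c 0%N * t)), 0%N.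
by move=> _ [k _ <-].
Qed.

Lemma sup_ramps_le_first t : sup_ramps h c t <= h 0%N.
Proof.
by apply: sup_ramps_le => k; rewrite ge_min h_noninc.
Qed.

(** On [a_k, b_k], with [h k = c k * a_k] and [b_k] so small that the ramps
    before the [k]-th stay below [h k], the supremum is attained by the
    [k]-th ramp, which is already flat. *)
Lemma sup_ramps_plateau k t : h k <= c k * t ->
  (forall j, (j < k)%N -> c j * t <= h k) -> sup_ramps h c t = h k.
Proof.
move=> hk cj; apply/eqP; rewrite eq_le; apply/andP; split; last first.
  by apply: le_trans (sup_ramps_ge t k); rewrite le_min lexx.
apply: sup_ramps_le => j; rewrite ge_min.
case: (ltnP j k) => [/cj ->|/h_noninc -> //]; exact: orbT.
Qed.

(** The supremum is small near 0 because, for heights tending to 0, all ramps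
    from some index on are small everywhere, and the finitely many others are
    Lipschitz. *)
Lemma modulus_sup_ramps : modulus (sup_ramps h c).
Proof.
split.
- apply/eqP; rewrite eq_le; apply/andP; split.
    by apply: sup_ramps_le => k; rewrite mulr0 ge_min lexx orbT.
  apply: le_trans (sup_ramps_ge 0 0%N).
  by rewrite mulr0 le_min lexx ltW.
- move=> s t s0 st; apply: sup_ramps_le => k.
  apply: le_trans (sup_ramps_ge t k).
  by rewrite le_min !ge_min lexx ler_pM2l // st orbT.
- move=> s t s0 t0; apply: sup_ramps_le => k.
  apply: le_trans (lerD (sup_ramps_ge s k) (sup_ramps_ge t k)).
  have := h_gt0 k; have := c_gt0 k; move: (c k) (h k) => u v u0 v0.
  have us : 0 <= u * s by rewrite mulr_ge0 // ltW.
  have ut : 0 <= u * t by rewrite mulr_ge0 // ltW.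
  by rewrite mulrDr /Num.min /Order.min; do 3 case: ifPn => ?; lra.
- move=> r r0.
  have [K hK] := h_cvg0 (divr_gt0 r0 (ltr0Sn R 1)).
  pose S := 1 + \sum_(j < K) c j.
  have S0 : 0 < S.
    by rewrite ltr_pwDl // sumr_ge0 // => j _; rewrite ltW.
  exists (r / 2 / S) => [|t t0 tS]; first by rewrite !divr_gt0.
  apply: (@le_lt_trans _ _ (r / 2)); last by lra.
  apply: sup_ramps_le => k; rewrite ge_min.
  case: (ltnP k K) => kK; last first.
    by rewrite (le_trans (h_noninc kK)) // ltW.
  apply/orP; right; apply: (@le_trans _ _ (S * t)); last first.
    by rewrite mulrC -ler_pdivlMr // ltW.
  apply: ler_wpM2r => //; rewrite /S (bigD1 (Ordinal kK)) //=.
  have : 0 <= \sum_(i < K | i != Ordinal kK) c i.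
    by apply: sumr_ge0 => j _; rewrite ltW.
  lra.
Qed.

End SupRamps.

(** * Adding a continuous pseudometric to a metric *)

Record continuous_pseudometric (R : realType) (X : Type) (d rho : X -> X -> R)
    : Prop := {
  pseudo_refl : forall x, rho x x = 0 ;
  pseudo_sym : forall x y, rho x y = rho y x ;
  pseudo_triangle : forall y x z, rho x z <= rho x y + rho y z ;
  pseudo_cts : forall x r, 0 < r ->
    exists2 s, 0 < s & forall y, d x y < s -> rho x y < r
}.

Section AddPseudometric.
Context (R : realType) (X : topologicalType).
Implicit Types (d : Met R X) (rho : X -> X -> R).

Lemma pseudo_ge0 (d rho : X -> X -> R) x y :
  continuous_pseudometric d rho -> 0 <= rho x y.
Proof.
move=> h; have := pseudo_triangle h y x x.
by rewrite (pseudo_refl h) (pseudo_sym h y x); lra.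
Qed.

Lemma add_pseudometric_is_metric d rho : continuous_pseudometric d rho ->
  is_metric (fun x y => d x y + rho x y).
Proof.
move=> h; have hd := met_is_metric d; split.
- by move=> x y; rewrite addr_ge0 ?(dist_ge0 hd) // (pseudo_ge0 _ _ h).
- move=> x y; split=> [|->]; last first.
    by rewrite (pseudo_refl h) addr0; apply/(dist_eq0 hd).
  have := dist_ge0 hd x y; have := pseudo_ge0 x y h => r0 d0 e.
  by apply/(dist_eq0 hd); lra.
- by move=> x y; rewrite (dist_sym hd) (pseudo_sym h).
- move=> y x z; have := dist_triangle hd y x z.
  have := pseudo_triangle h y x z; lra.
Qed.

(** The balls of [d + rho] lie in those of [d], and the continuity of [rho]
    gives balls of [d] inside them. *)
Lemma add_pseudometric_generates d rho : continuous_pseudometric d rho ->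
  generates_topology (fun x y => d x y + rho x y).
Proof.
move=> h U; rewrite (met_generates d U); split=> UO x Ux.
  have [r r0 rU] := UO x Ux; exists r => // y /= yr; apply: rU => /=.
  by have := pseudo_ge0 x y h; lra.
have [r r0 rU] := UO x Ux.
have r20 : 0 < r / 2 by lra.
have [s s0 sr] := pseudo_cts h x r20.
exists (Num.min s (r / 2)); first by rewrite lt_min s0.
move=> y /=; rewrite lt_min => /andP[/sr ys yr]; apply: rU => /=; lra.
Qed.

Definition add_pseudometric d rho (h : continuous_pseudometric d rho) : Met R X :=
  MkMet (add_pseudometric_is_metric h) (add_pseudometric_generates h).

Lemma met_dist_add_pseudometric d rho (h : continuous_pseudometric d rho) r :
  0 <= r -> (forall x y, rho x y <= r) ->
  (met_dist d (add_pseudometric h) <= r%:E)%E.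
Proof.
move=> r0 rhor; apply: ge_ereal_sup => _ [[x y] _ <-] /=.
rewrite lee_fin (_ : d x y - (d x y + rho x y) = - rho x y); last by lra.
by rewrite normrN ger0_norm // (pseudo_ge0 _ _ h).
Qed.

(** The monotonicity and subadditivity of [eta] are what makes [eta \o d]
    satisfy the triangle inequality. *)
Lemma modulus_pseudometric d (eta : R -> R) : modulus eta ->
  continuous_pseudometric d (fun x y => eta (d x y)).
Proof.
move=> he; have hd := met_is_metric d; split.
- by move=> x; rewrite (proj2 (dist_eq0 hd x x) erefl) (modulus0 he).
- by move=> x y; rewrite (dist_sym hd).
- move=> y x z; apply: le_trans (modulusD he (dist_ge0 hd _ _) (dist_ge0 hd _ _)).
  by apply: (modulus_le he); [exact: dist_ge0 hd _ _|exact: dist_triangle].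
- move=> x r /(modulus_lt he)[s s0 sr]; exists s => // y.
  exact/sr/(dist_ge0 hd).
Qed.

(** Continuity comes from [`|eta (d p x) - eta (d p y)| <= eta (d x y)]: a
    monotone subadditive function is its own modulus of continuity. *)
Lemma modulus_radial_pseudometric d (eta : R -> R) p : modulus eta ->
  continuous_pseudometric d (fun x y => `|eta (d p x) - eta (d p y)|).
Proof.
move=> he; have hd := met_is_metric d; split.
- by move=> x; rewrite subrr normr0.
- by move=> x y; rewrite distrC.
- by move=> y x z; exact: ler_distD.
- move=> x r /(modulus_lt he)[s s0 sr]; exists s => // y xy.
  have radial u v : eta (d p u) - eta (d p v) <= eta (d u v).
    rewrite lerBlDl.
    apply: le_trans (modulusD he (dist_ge0 hd _ _) (dist_ge0 hd _ _)).
    apply: (modulus_le he); first exact: dist_ge0 hd _ _.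
    by rewrite (dist_sym hd u v); exact: dist_triangle.
  apply: le_lt_trans (sr _ (dist_ge0 hd x y) xy).
  rewrite ler_norml radial andbT.
  by have := radial y x; rewrite (dist_sym hd y x); lra.
Qed.

End AddPseudometric.

(** * Finite sets clustering at a non-isolated point *)

Section Clusters.
Context (R : realType) (X : topologicalType) (d : Met R X).

Lemma nondiscrete_accumulation : ~ discrete_space X ->
  exists p, forall r, 0 < r -> exists2 y, y <> p & d p y < r.
Proof.
move=> /existsNP[U]; rewrite (met_generates d U) => /existsNP[p].
move=> /not_implyP[Up pU]; exists p => r r0; apply: contrapT => nopt.
apply: pU; exists r => // y /= yr; have [->//|yp] := pselect (y = p).
by case: nopt; exists y.
Qed.

Context (p : X).
Hypothesis p_acc : forall r, 0 < r -> exists2 y, y <> p & d p y < r.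

(** Points are added one at a time, each so much closer to [p] than the
    previous ones that it stays away from all of them. *)
Lemma finite_cluster k r : 0 < r -> exists (a : R) (A : {fset X}),
  [/\ 0 < a, p \in A, #|` A| = k.+1,
      forall x, x \in A -> d p x < r &
      forall x y, x \in A -> y \in A -> x <> y -> a <= d x y].
Proof.
have hd := met_is_metric d.
move=> r0; elim: k => [|k [a [A [a0 pA cA Ar Aa]]]].
  exists 1, [fset p]%fset; split => //.
  - by rewrite inE.
  - by rewrite cardfs1.
  - by move=> x; rewrite inE => /eqP ->; rewrite (proj2 (dist_eq0 hd p p) erefl).
  - by move=> x y; rewrite !inE => /eqP -> /eqP ->.
have [|y yp py] := @p_acc (Num.min (a / 2) r); first by rewrite lt_min; lra.
move: py; rewrite lt_min => /andP[ya yr].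
have py0 : 0 < d p y.
  rewrite lt_neqAle (dist_ge0 hd) andbT eq_sym; apply/eqP => /(dist_eq0 hd) py.
  by apply: yp; rewrite py.
have yA : y \notin A.
  by apply/negP => yA; have := Aa p y pA yA (nesym yp); lra.
have far x : x \in A -> Num.min (a / 2) (d p y) <= d x y.
  move=> xA; rewrite ge_min; have [->|xp] := pselect (x = p).
    by rewrite lexx orbT.
  have := dist_triangle hd y x p; rewrite (dist_sym hd y p).
  have := Aa x p xA pA xp => *; apply/orP; left; lra.
exists (Num.min (a / 2) (d p y)), (y |` A)%fset; split.
- by rewrite lt_min py0; lra.
- by rewrite in_fset1U pA orbT.
- by rewrite cardfsU1 yA cA.
- by move=> x; rewrite in_fset1U => /orP[/eqP ->|/Ar].
- move=> x z; rewrite !in_fset1U => /orP[/eqP ->|xA] /orP[/eqP ->|zA] xz //.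
  + by rewrite (dist_sym hd y); exact: far.
  + exact: far.
  + by rewrite ge_min; have := Aa x z xA zA xz => *; apply/orP; left; lra.
Qed.

Context (h : nat -> R).
Hypothesis h_gt0 : forall k, 0 < h k.
Hypothesis h_noninc : forall j k, (j <= k)%N -> h k <= h j.
Hypothesis h_cvg0 : forall r, 0 < r -> exists K, h K < r.

(** The sets are chosen one after the other: once the ramps of slope [c j],
    [j < k], are fixed, the [k]-th set is taken in a ball so small that all
    of them stay below [h k] at the distances it realizes, and [c k] is then
    the slope for which the [k]-th ramp reaches [h k] at its smallest
    distance. *)
Lemma plateau_clusters : exists (eta : R -> R) (A : nat -> {fset X}),
  [/\ modulus eta, forall t, eta t <= h 0%N &
    forall k, [/\ p \in A k, #|` A k| = k.+2 &
      forall x y, x \in A k -> y \in A k -> x <> y ->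
        d x y <= h k ^+ 2 /\ eta (d x y) = h k]].
Proof.
have hd := met_is_metric d.
have /choice[f fP] (kS : nat * R) : exists aA : R * {fset X},
    [/\ 0 < aA.1, p \in aA.2, #|` aA.2| = kS.1.+2 &
     forall x y, x \in aA.2 -> y \in aA.2 -> x <> y ->
       [/\ aA.1 <= d x y, d x y <= h kS.1 ^+ 2 & kS.2 * d x y <= h kS.1]].
  case: kS => k S /=; have hk := h_gt0 k.
  have S1 : 0 < 1 + `|S| by have := normr_ge0 S; lra.
  set b := Num.min (h k ^+ 2) (h k / (1 + `|S|)).
  have b0 : 0 < b by rewrite lt_min exprn_gt0 // divr_gt0.
  have [a [A [a0 pA cA Ab Aa]]] := @finite_cluster k.+1 _ (divr_gt0 b0 (ltr0Sn R 1)).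
  exists (a, A); split => // x y xA yA xy /=.
  have xyb : d x y <= b.
    have := dist_triangle hd p x y; rewrite (dist_sym hd x p).
    have := Ab x xA; have := Ab y yA; lra.
  move: (xyb); rewrite le_min => /andP[xy2 xyS]; split => //; first exact: Aa.
  apply: le_trans (_ : (1 + `|S|) * d x y <= _); last first.
    by rewrite mulrC -ler_pdivlMr.
  apply: ler_wpM2r; first exact: dist_ge0.
  by have := ler_norm S; lra.
pose S := fix S k := if k is j.+1 then S j + h j / (f (j, S j)).1 else 0.
pose c k := h k / (f (k, S k)).1.
have c_gt0 k : 0 < c k by rewrite divr_gt0 //; case: (fP (k, S k)).
have S_ge0 k : 0 <= S k.
  by elim: k => //= k IH; rewrite addr_ge0 // ltW // c_gt0.
have cS j k : (j < k)%N -> c j <= S k.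
  elim: k => //= k IH; rewrite ltnS leq_eqVlt => /orP[/eqP ->|/IH jk].
    by rewrite lerDr.
  by apply: le_trans jk _; rewrite lerDl ltW // c_gt0.
exists (sup_ramps h c), (fun k => (f (k, S k)).2); split.
- exact: modulus_sup_ramps.
- exact: sup_ramps_le_first.
move=> k; have [a0 pA cA Axy] := fP (k, S k); split => // x y xA yA xy.
have [/= axy xy2 Sxy] := Axy x y xA yA xy; split => //.
apply: sup_ramps_plateau => //.
  by rewrite /c mulrAC ler_pdivlMr // ler_wpM2l // ltW.
move=> j jk; apply: le_trans Sxy; apply: ler_wpM2r; first exact: dist_ge0.
exact: cS.
Qed.

End Clusters.

(** * Witnesses of the two failures *)

Section Witnesses.
Context (R : realType) (X : choiceType) (d : X -> X -> R).
Hypothesis d_metric : is_metric d.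

Lemma metric_gt0 x y : x <> y -> 0 < d x y.
Proof.
move=> xy; rewrite lt_neqAle (dist_ge0 d_metric) andbT eq_sym.
by apply/eqP => /(dist_eq0 d_metric).
Qed.

Lemma two_points (A : {fset X}) : (2 <= #|` A|)%N ->
  exists x y, [/\ x \in A, y \in A & x <> y].
Proof.
move=> A2; have /fset0Pn[x xA] : A != fset0 by rewrite -cardfs_gt0 ltnW.
have /fset0Pn[y] : (A `\ x)%fset != fset0.
  by rewrite -cardfs_gt0; move: A2; rewrite (cardfsD1 x) xA.
by rewrite !inE => /andP[/eqP yx yA]; exists x, y; split=> // /esym.
Qed.

(** The diameter and the separation of a finite set are attained, hence real
    numbers, the second positive; afterwards only the inequalities below
    matter. *)
Lemma fine_diameter_separation (A : {fset X}) : (2 <= #|` A|)%N ->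
  [/\ 0 < fine (separation d [set` A]),
      forall x y, x \in A -> y \in A -> x <> y ->
        fine (separation d [set` A]) <= d x y <= fine (diameter d [set` A]) &
      forall s t, (forall x y, x \in A -> y \in A -> x <> y -> s <= d x y <= t) ->
        s <= fine (separation d [set` A]) /\ fine (diameter d [set` A]) <= t].
Proof.
move=> A2.
have [x0 [y0 [x0A y0A xy0]]] := two_points A2.
pose D (i : A * A) := d (val i.1) (val i.2).
pose P (i : A * A) := i.1 != i.2.
have Pxy x y (xA : x \in A) (yA : y \in A) : x <> y -> P ([` xA]%fset, [` yA]%fset).
  by move=> xy; apply/eqP => /(congr1 val).
have Pi0 := Pxy _ _ x0A y0A xy0.
have PE i : P i -> val i.1 <> val i.2 by move=> /eqP + /val_inj.
have [imin Pmin minP] := arg_minP D Pi0.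
have [imax Pmax maxP] := arg_maxP D Pi0.
have sepE : separation d [set` A] = (D imin)%:E.
  apply/eqP; rewrite eq_le; apply/andP; split.
    apply: ereal_inf_lbound; exists (val imin.1), (val imin.2).
    by split=> //; [exact: valP|exact: valP|exact: PE].
  apply: le_ereal_inf_tmp => _ [x [y [/= xA yA xy ->]]]; rewrite lee_fin.
  exact: (minP _ (Pxy _ _ xA yA xy)).
have diamE : diameter d [set` A] = (D imax)%:E.
  apply/eqP; rewrite eq_le; apply/andP; split; last first.
    apply: ereal_sup_ubound; exists (val imax.1), (val imax.2).
    by split=> //; exact: valP.
  apply: ge_ereal_sup => _ [x [y [/= xA yA ->]]]; rewrite lee_fin.
  have [->|xy] := pselect (x = y); last exact: (maxP _ (Pxy _ _ xA yA xy)).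
  by rewrite (proj2 (dist_eq0 d_metric y y) erefl) (dist_ge0 d_metric).
rewrite sepE diamE /=; split.
- exact/metric_gt0/PE.
- move=> x y xA yA xy; have Pi := Pxy _ _ xA yA xy; apply/andP; split.
    exact: (minP _ Pi).
  exact: (maxP _ Pi).
- move=> s t st; split.
    by have /andP[] := st _ _ (valP imin.1) (valP imin.2) (PE _ Pmin).
  by have /andP[] := st _ _ (valP imax.1) (valP imax.2) (PE _ Pmax).
Qed.

Definition doubling_violation (n : nat) (A : {fset X}) (s t : R) : Prop :=
  [/\ (2 <= #|` A|)%N, 0 < s,
      forall x y, x \in A -> y \in A -> x <> y -> s < d x y < t &
      n.+1%:R * (t / s) ^+ n.+1 < #|` A|%:R].

(** One parameter [n] is enough for the constant and the exponent, since
    the ratio of diameter to separation is at least 1. The bounds [s] and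
    [t] replace separation and diameter so that a violation consists of
    strict inequalities between finitely many distances. *)
Lemma not_doublingP :
  ~ doubling d <-> forall n, exists A s t, doubling_violation n A s t.
Proof.
split=> [nd n|viol [C [lam [C0 lam0 dbl]]]].
  apply: contrapT => noviol; apply: nd.
  (* halving the separation and doubling the diameter makes the inequalities
     strict, at the cost of a factor 4 *)
  exists (n.+1%:R * 4 ^+ n.+1), n.+1%:R; split => [||A A2].
  - by rewrite mulr_gt0 // exprn_gt0.
  - by [].
  have [sep0 Ast Ale] := fine_diameter_separation A2.
  move: (fine (diameter _ _)) (fine (separation _ _)) sep0 Ast {Ale}.
  move=> t s s0 Ast; rewrite leNgt; apply/negP => ltA; apply: noviol.
  exists A, (s / 2), (2 * t); split => // [|x y xA yA xy|].
  - by rewrite divr_gt0.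
  - by have := Ast x y xA yA xy; have := metric_gt0 xy; lra.
  rewrite (_ : 2 * t / (s / 2) = 4 * (t / s)); last by field; rewrite gt_eqF.
  have t0 : 0 <= t.
    have [x [y [xA yA xy]]] := two_points A2.
    by have := Ast x y xA yA xy; have := metric_gt0 xy; lra.
  by rewrite exprMn mulrA -[(t / s) ^+ _]powR_mulrn // divr_ge0 // ltW.
pose n := Num.truncn (Num.max C lam).
have : Num.max C lam < n.+1%:R by exact: truncnS_gt.
rewrite gt_max => /andP[Cn lamn].
have [A [s [t [A2 s0 Ast]]]] := viol n; apply/negP; rewrite -leNgt.
apply: le_trans (dbl A A2) _.
have [sep0 Ale Abnd] := fine_diameter_separation A2.
have [x [y [xA yA xy]]] := two_points A2.
have := Ale _ _ xA yA xy; have := Ast _ _ xA yA xy.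
have [|] := Abnd s t; first by move=> u v uA vA uv; have := Ast _ _ uA vA uv; lra.
move: (fine (diameter _ _)) (fine (separation _ _)) sep0 => u v v0 sv ut *.
have ts1 : 1 <= t / s by rewrite ler_pdivlMr // mul1r; lra.
have uv0 : 0 <= u / v by rewrite divr_ge0 // ltW //; lra.
have uvts : u / v <= t / s.
  by apply: ler_pM => //; [lra|rewrite invr_ge0 ltW|rewrite lef_pV2].
apply: ler_pM; [exact: ltW|exact: powR_ge0|exact: ltW|].
rewrite -powR_mulrn; last by rewrite (le_trans _ ts1).
apply: (le_trans (ge0_ler_powR (ltW lam0) _ _ uvts)); rewrite ?nnegrE //.
  by rewrite (le_trans _ ts1).
by apply: ler_powR => //; exact: ltW.
Qed.

Definition disconnected_violation (n N : nat) (z : nat -> X) : Prop :=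
  (1 < N)%N /\ forall i, (1 <= i < N)%N -> n.+2%:R * d (z i) (z i.+1) < d (z 1%N) (z N).

Lemma not_uniformly_disconnectedP : ~ uniformly_disconnected d <->
  forall n, exists N z, disconnected_violation n N z.
Proof.
split=> [nd n|viol [delta /andP[delta0 delta1] ud]].
  apply: contrapT => noviol; apply: nd.
  exists n.+2%:R^-1.
    by rewrite invr_gt0 ltr0n /= invf_lt1 ?ltr1n ?ltr0n.
  move=> N z N1; rewrite leNgt; apply/negP => lez; apply: noviol.
  exists N, z; split=> // i iN; rewrite -ltr_pdivlMl ?ltr0n //.
  apply: le_lt_trans lez.
  by rewrite (bigD1_seq i) ?mem_index_iota ?iota_uniq //= le_max lexx.
pose n := Num.truncn delta^-1.
have dn : delta^-1 < n.+2%:R.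
  by apply: lt_trans (truncnS_gt _) _; rewrite ltr_nat.
have [N [z [N1 zP]]] := viol n.
have := ud N z N1; apply/negP; rewrite -ltNge.
have zN0 : 0 < d (z 1%N) (z N).
  apply: le_lt_trans (zP 1%N _); last by rewrite N1.
  by rewrite mulr_ge0 // (dist_ge0 d_metric).
rewrite big_nat; apply: bigmax_lt; first by rewrite mulr_gt0.
move=> i iN; rewrite -ltr_pdivrMl //; apply: le_lt_trans (zP i iN).
by rewrite ler_wpM2r ?(dist_ge0 d_metric) // ltW.
Qed.

End Witnesses.

(** * Openness of the violations *)

Section Gdelta.
Context (R : realType) (X : topologicalType).
Implicit Types d e : Met R X.

(** The neighbourhood does not depend on the points: near [d], distances are
    close uniformly on the whole space. *)
Lemma near_met d r : 0 < r ->
  \forall e \near d, forall x y, `|d x y - (e : Met R X) x y| < r.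
Proof.
move=> r0; apply/nbhs_ballP; exists r => // e.
rewrite /ball /= /met_ball /= => de x y; rewrite -lte_fin.
by apply: le_lt_trans de; apply: ereal_sup_ubound; exists (x, y).
Qed.

Lemma open_doubling_violation n :
  open [set d : Met R X | exists A s t, doubling_violation d n A s t].
Proof.
rewrite openE => d [A [s [t [A2 s0 Ast An]]]].
suff dA : \forall e \near d, forall i : A * A, val i.1 <> val i.2 ->
    s < (e : Met R X) (val i.1) (val i.2) < t.
  apply: (@filterS _ _ (nbhs_filter d) _ _ _ dA) => e eA.
  exists A, s, t; split => // x y xA yA.
  exact: (eA ([` xA]%fset, [` yA]%fset)).
apply: (@filter_forall _ _ _ _ (nbhs_filter d)) => -[x y].
have [xy|xy] := pselect (val x = val y).
  by apply: (@nearW _ _ _ (nbhs_filter d)) => e /(_ xy).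
have /andP[sxy xyt] := Ast _ _ (valP x) (valP y) xy.
have r0 : 0 < Num.min (d (val x) (val y) - s) (t - d (val x) (val y)).
  by rewrite lt_min !subr_gt0 sxy.
apply: (@filterS _ _ (nbhs_filter d) _ _ _ (near_met d r0)) => e /(_ (val x) (val y)).
by rewrite lt_min !ltr_norml => /andP[/andP[? ?] /andP[? ?]] _; lra.
Qed.

Lemma open_disconnected_violation n :
  open [set d : Met R X | exists N z, disconnected_violation d n N z].
Proof.
rewrite openE => d [N [z [N1 zP]]].
suff dz : \forall e \near d, forall i : 'I_N, (1 <= i)%N ->
    n.+2%:R * (e : Met R X) (z i) (z i.+1) < e (z 1%N) (z N).
  apply: (@filterS _ _ (nbhs_filter d) _ _ _ dz) => e ez.
  exists N, z; split => // i /andP[i1 iN]; exact: (ez (Ordinal iN)).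
apply: (@filter_forall _ _ _ _ (nbhs_filter d)) => i.
case: (posnP i) => [i0|i1].
  by apply: (@nearW _ _ _ (nbhs_filter d)) => e; rewrite i0.
pose gap := d (z 1%N) (z N) - n.+2%:R * d (z i) (z i.+1).
have gap0 : 0 < gap by rewrite subr_gt0 zP // i1 /=.
(* n + 3 is the total weight of the two distances in the inequality *)
pose u := gap / n.+3%:R.
have u0 : 0 < u by rewrite divr_gt0.
have gapE : gap = (n.+2%:R + 1) * u by rewrite natr1 /u mulrC divfK.
apply: (@filterS _ _ (nbhs_filter d) _ _ _ (near_met d u0)) => e de _.
have := de (z 1%N) (z N); have := de (z i) (z i.+1).
rewrite !ltr_norml => /andP[ei _] /andP[_ eN].
have : n.+2%:R * (e (z i) (z i.+1) - d (z i) (z i.+1)) < n.+2%:R * u.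
  by rewrite ltr_pM2l ?ltr0n //; lra.
by move: gapE eN; rewrite /gap; lra.
Qed.

Lemma Gdelta_not_doubling : Gdelta [set d : Met R X | ~ doubling d].
Proof.
exists (fun n => [set d : Met R X | exists A s t, doubling_violation d n A s t]).
  exact: open_doubling_violation.
apply/seteqP; split=> d.
  by move=> /(not_doublingP (met_is_metric d)) viol n _; exact: viol.
by move=> viol; apply/(not_doublingP (met_is_metric d)) => n; exact: viol.
Qed.

Lemma Gdelta_not_uniformly_disconnected :
  Gdelta [set d : Met R X | ~ uniformly_disconnected d].
Proof.
exists (fun n => [set d : Met R X | exists N z, disconnected_violation d n N z]).
  exact: open_disconnected_violation.
apply/seteqP; split=> d.
  by move=> /(not_uniformly_disconnectedP (met_is_metric d)) viol n _; exact: viol.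
move=> viol; apply/(not_uniformly_disconnectedP (met_is_metric d)) => n.
exact: viol.
Qed.

End Gdelta.

(** * Density *)

Section Density.
Context (R : realType) (X : topologicalType).
Implicit Types d e : Met R X.

Lemma dense_add_pseudometric (P : set (Met R X)) :
  (forall d r, 0 < r -> exists rho (h : continuous_pseudometric d rho),
    (forall x y, rho x y <= r) /\ P (add_pseudometric h)) ->
  dense P.
Proof.
move=> hP O [d Od] /open_MetE /(_ d Od)[r r0 rO].
have r20 : 0 < r / 2 by lra.
have [rho [h [rhor Ph]]] := hP d _ r20.
exists (add_pseudometric h); split => //; apply: rO => /=.
apply: le_lt_trans (met_dist_add_pseudometric h (ltW r20) rhor) _.
by rewrite lte_fin; lra.
Qed.

(** The heights [b / (k + 1)] serve both constructions: they tend to zero,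
    and from the [M]-th to the [(2 M + 1)]-th they fall by half in steps that
    are of smaller order than [1 / M]. *)
Lemma harmonic_plateau_clusters d b : ~ discrete_space X -> 0 < b ->
  exists p (eta : R -> R) (A : nat -> {fset X}),
  [/\ modulus eta, forall t, eta t <= b &
    forall k, [/\ p \in A k, #|` A k| = k.+2 &
      forall x y, x \in A k -> y \in A k -> x <> y ->
        d x y <= (b / k.+1%:R) ^+ 2 /\ eta (d x y) = b / k.+1%:R]].
Proof.
move=> /(nondiscrete_accumulation d)[p p_acc] b0; exists p.
have h0 k : 0 < b / k.+1%:R by rewrite divr_gt0.
have hle j k : (j <= k)%N -> b / k.+1%:R <= b / j.+1%:R.
  by move=> jk; rewrite ler_pM2l // lef_pV2 ?posrE ?ltr0n // ler_nat.
have hcvg r : 0 < r -> exists K, b / K.+1%:R < r.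
  move=> r0; exists (Num.truncn (b / r)).
  by rewrite ltr_pdivrMr ?ltr0n // mulrC -ltr_pdivrMr // truncnS_gt.
have [eta [A [meta etab Ak]]] := plateau_clusters p_acc h0 hle hcvg.
by exists eta, A; split => // t; have := etab t; rewrite divr1.
Qed.

(** In the new metric the distances in the [k]-th cluster lie between [h] and
    [2 h], where [h] is its height, so the clusters are sets of unbounded
    cardinality whose ratio of diameter to separation is bounded. *)
Lemma dense_not_doubling : ~ discrete_space X ->
  dense [set d : Met R X | ~ doubling d].
Proof.
move=> nX; apply: dense_add_pseudometric => d r r0.
have b0 : 0 < Num.min r 1 by rewrite lt_min r0 /=.
have [p [eta [A [meta etab Ak]]]] := harmonic_plateau_clusters d nX b0.
have b1 : Num.min r 1 <= 1 by rewrite ge_min lexx orbT.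
have br : Num.min r 1 <= r by rewrite ge_min lexx.
move: (Num.min r 1) b0 b1 br etab Ak => b b0 b1 br etab Ak.
exists (fun x y => eta (d x y)), (modulus_pseudometric d meta); split.
  by move=> x y; apply: le_trans br.
apply/(not_doublingP (met_is_metric _)) => n.
(* with the strict bounds h / 2 and 3 h the ratio to beat is 6 *)
pose k := (n.+1 * 6 ^ n.+1)%N; have [_ cA Axy] := Ak k.
have h0 : 0 < b / k.+1%:R by rewrite divr_gt0.
have h1 : b / k.+1%:R <= 1.
  by rewrite ler_pdivrMr ?ltr0n // mul1r (le_trans b1) // ler1n.
move: (b / k.+1%:R) h0 h1 Axy => h h0 h1 Axy.
exists (A k), (h / 2), (3 * h); split.
- by rewrite cA.
- by lra.
- move=> x y xA yA xy; have [dxy exy] := Axy x y xA yA xy.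
  rewrite /= exy; have := dist_ge0 (met_is_metric d) x y.
  have : h ^+ 2 <= h by rewrite expr2 ger_pMl.
  lra.
rewrite cA (_ : 3 * h / (h / 2) = 6%:R); last by field; rewrite gt_eqF.
by rewrite -natrX -natrM ltr_nat ltnS leqnSn.
Qed.

(** One point is chosen in each cluster. Among the clusters from the [M]-th
    to the [(2 M + 1)]-th, consecutive points are at a new distance of at most
    [3 b / (M + 1) ^ 2], the end points at one of at least
    [b / (2 (M + 1))]. *)
Lemma dense_not_uniformly_disconnected : ~ discrete_space X ->
  dense [set d : Met R X | ~ uniformly_disconnected d].
Proof.
move=> nX; apply: dense_add_pseudometric => d r r0.
have b0 : 0 < Num.min r 1 by rewrite lt_min r0 /=.
have [p [eta [A [meta etab Ak]]]] := harmonic_plateau_clusters d nX b0.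
have b1 : Num.min r 1 <= 1 by rewrite ge_min lexx orbT.
have br : Num.min r 1 <= r by rewrite ge_min lexx.
move: (Num.min r 1) b0 b1 br etab Ak => b b0 b1 br etab Ak.
have hd := met_is_metric d.
have eta0 x y : 0 <= eta (d x y).
  by rewrite -(modulus0 meta); apply: (modulus_le meta) => //; exact: dist_ge0.
exists (fun x y => `|eta (d p x) - eta (d p y)|).
exists (modulus_radial_pseudometric d p meta); split.
  move=> x y; apply: le_trans br.
  have := eta0 p x; have := eta0 p y; have := etab (d p x); have := etab (d p y).
  by rewrite ler_norml; lra.
apply/(not_uniformly_disconnectedP (met_is_metric _)) => n.
have /choice[x xP] k : exists x,
    d p x <= (b / k.+1%:R) ^+ 2 /\ eta (d p x) = b / k.+1%:R.
  have [pA cA Axy] := Ak k.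
  have /fset0Pn[x] : (A k `\ p)%fset != fset0.
    by rewrite -cardfs_gt0; move: cA; rewrite (cardfsD1 p) pA add1n => -[->].
  rewrite !inE => /andP[/eqP xp xA]; exists x.
  by apply: Axy => // /esym.
(* 6 n.+2 < M + 1 is what the comparison of 3 b n.+2 / (M + 1) ^ 2 with
   b / (2 (M + 1)) amounts to *)
have [M M6] : exists M, (6 * n.+2 <= M)%N by exists (6 * n.+2)%N.
have M0 : 0 < M.+1%:R :> R by rewrite ltr0n.
exists M.+2, (fun i => x (M + i).-1); split => //= i /andP[i1 _].
have -> : (M + i.+1).-1 = (M + i).-1.+1 by case: i i1 => // i _; rewrite !addnS.
have : (M <= (M + i).-1)%N by case: i i1 => // i _; rewrite addnS leq_addr.
move: (M + i).-1 => j Mj.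
rewrite !addnS addn0 /=.
rewrite !(proj2 (xP _)).
have heights0 k : 0 < b / k.+1%:R by rewrite divr_gt0.
have drop k : b / k.+1%:R - b / k.+2%:R = b / (k.+1%:R * k.+2%:R).
  rewrite -[k.+2%:R]natr1; field.
  by rewrite !(natr1, nat1r) !pnatr_eq0.
have Mj1 : M.+1%:R <= j.+1%:R :> R by rewrite ler_nat.
have Mj2 : M.+1%:R <= j.+2%:R :> R by rewrite ler_nat leqW.
have sq k : M.+1%:R <= k.+1%:R :> R -> d p (x k) <= b / M.+1%:R ^+ 2.
  move=> Mk; apply: le_trans (proj1 (xP k)) _; rewrite expr_div_n.
  apply: ler_pM.
  - by rewrite ltW // exprn_gt0.
  - by rewrite ltW // invr_gt0 exprn_gt0.
  - by rewrite expr2 ger_pMl.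
  - by rewrite lef_pV2 ?posrE ?exprn_gt0 ?ltr0n // lerXn2r ?nnegrE ?ler0n.
have step : d (x j) (x j.+1) + `|b / j.+1%:R - b / j.+2%:R| <= 3 * (b / M.+1%:R ^+ 2).
  have : `|b / j.+1%:R - b / j.+2%:R| <= b / M.+1%:R ^+ 2.
    rewrite drop ger0_norm; last by rewrite ltW // divr_gt0 // mulr_gt0.
    rewrite ler_pM2l // lef_pV2 ?posrE ?mulr_gt0 ?exprn_gt0 ?ltr0n // expr2.
    by apply: ler_pM.
  have := dist_triangle hd p (x j) (x j.+1); rewrite (dist_sym hd (x j) p).
  have := sq j Mj1; have := sq j.+1 Mj2.
  by move: (b / M.+1%:R ^+ 2) `|_ - _| => q w; lra.
have total : b / M.+1%:R - b / (M + M).+2%:R = b / M.+1%:R / 2.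
  rewrite (_ : (M + M).+2%:R = 2 * M.+1%:R); first by field; rewrite gt_eqF.
  by rewrite -addnS -addSn natrD; ring.
apply: le_lt_trans (ler_wpM2l (ler0n _ _) step) _.
apply: lt_le_trans (ler_wpDl (dist_ge0 hd _ _) (ler_norm _)).
rewrite total -subr_gt0.
rewrite (_ : _ - _ = b / M.+1%:R ^+ 2 / 2 * (M.+1%:R - 6 * n.+2%:R)).
  by rewrite mulr_gt0 ?divr_gt0 ?exprn_gt0 // subr_gt0 -natrM ltr_nat ltnS.
by field; rewrite gt_eqF.
Qed.

End Density.

Theorem theorem4p12 (R : realType) (X : topologicalType)
    (metrizableX : metrizable R X) (nondiscreteX : ~ discrete_space X) :
  (dense [set d : Met R X | ~ doubling d] /\
   Gdelta [set d : Met R X | ~ doubling d]) /\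
  (dense [set d : Met R X | ~ uniformly_disconnected d] /\
   Gdelta [set d : Met R X | ~ uniformly_disconnected d]).
Proof.
split; split.
- exact: dense_not_doubling.
- exact: Gdelta_not_doubling.
- exact: dense_not_uniformly_disconnected.
- exact: Gdelta_not_uniformly_disconnected.
Qed.
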